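(* Let $T$ be a tree and let $G$ be a closed subgroup of $\mathrm{Aut}(T)$. Assume that no proper non-empty subtree of $T$ is invariant under $G$ and that no end of $T$ is fixed by $G$. Assume also that $G$ has property H. If $N$ is a non-trivial closed subgroup of $G$ normalized by $G^{++}$, then $N$ contains $G^{++}$. In particular, the group $G^{++}$ is topologically simple.
   Context: A tree is a connected simple graph without non-trivial cycles; it is not assumed to be locally finite. A ray in $T$ is a sequence $(v_i)_{i\in\mathbf{N}}$ of distinct vertices with $v_i$ adjacent to $v_{i+1}$ for all $i$. Two rays of $T$ are equivalent if their intersection is a ray, and an end of $T$ is an equivalence class of rays; $\mathrm{Aut}(T)$ acts on the set of ends. Topology: $\mathrm{Aut}(T)$ carries the permutation topology coming from its action on the vertex set $VT$, in which the pointwise stabilizers of finite subsets of $VT$ form a neighbourhood basis of the identity (equivalently, the topology of pointwise convergence on the discrete set $VT$). ''Closed'' refers to this topology, and subgroups carry the induced topology. Half-trees: if $e$ is an edge of $T$ such that both components of $T\setminus\{e\}$ are infinite, then each of these two components is called a half-tree of $T$. The pointwise stabilizer in $G$ of a half-tree is the subgroup of all elements of $G$ fixing every vertex of it. Property H: a subgroup $G\le\mathrm{Aut}(T)$ has property H if the pointwise stabilizer in $G$ of every half-tree of $T$ is non-trivial. $G^{++}$ denotes the closure of the subgroup of $G$ generated by the pointwise stabilizers in $G$ of all half-trees of $T$. A topological group is topologically simple if its only closed normal subgroups are the trivial subgroup and the whole group. *)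

(* Defs.v *)
From HB Require Import structures.
From mathcomp Require Import all_boot.
From mathcomp Require Import all_classical.
From mathcomp Require Import topology.

Set Implicit Arguments.
Unset Strict Implicit.
Unset Printing Implicit Defensive.

Local Open Scope classical_set_scope.
Local Open Scope group_scope.

(* The vertex set is an arbitrary choiceType, which classically is no
   restriction on an arbitrary type, so T need not be countable or locally
   finite. A cycle [:: x; y] of size 2 runs back and forth along one edge and
   is the only kind of duplicate-free closed walk that a tree has. *)
Record tree := Tree {
  vertex :> choiceType;
  adj : rel vertex;
  adj_sym : symmetric adj;
  adj_irr : irreflexive adj;
  tree_connected : forall x y, exists2 p, path adj x p & last x p = y;
  tree_acyclic : forall c : seq vertex, ucycle adj c -> (size c <= 2)%N
}.
Arguments adj {t}.

Section Aut.
Variable T : tree.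

(* The inverse is stored as data; it is determined by the underlying function
   (see aut_inj). *)
Record aut := Aut {
  aut_fun :> T -> T;
  aut_inv : T -> T;
  aut_funK : cancel aut_fun aut_inv;
  aut_invK : cancel aut_inv aut_fun;
  aut_adj : {mono aut_fun : x y / adj x y}
}.

Lemma aut_inj (g h : aut) : g =1 h -> g = h.
Proof.
case: g h => [f f' fK f'K fA] [g g' gK g'K gA] /= /funext fg; subst g.
have f'g' : f' = g' by apply/funext => x; rewrite -{1}(g'K x) fK.
by subst g'; congr Aut; apply: Prop_irrelevance.
Qed.

Lemma aut_inv_adj (g : aut) : {mono aut_inv g : x y / adj x y}.
Proof. by move=> x y; rewrite -[LHS](aut_adj g) !aut_invK. Qed.

Definition aut1 : aut :=
  @Aut id id (fun=> erefl) (fun=> erefl) (fun _ _ => erefl).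

Lemma aut_comp_adj (g h : aut) : {mono g \o h : x y / adj x y}.
Proof. by move=> x y /=; rewrite !aut_adj. Qed.

Definition aut_comp (g h : aut) : aut :=
  @Aut (g \o h) (aut_inv h \o aut_inv g)
    (can_comp (aut_funK g) (aut_funK h)) (can_comp (aut_invK h) (aut_invK g))
    (@aut_comp_adj g h).

Definition aut_opp (g : aut) : aut :=
  Aut (aut_invK g) (aut_funK g) (@aut_inv_adj g).

HB.instance Definition _ := gen_eqMixin aut.
HB.instance Definition _ := gen_choiceMixin aut.

Lemma aut_compA : associative aut_comp.
Proof. by move=> g h k; exact: aut_inj. Qed.
Lemma aut_comp1 : left_id aut1 aut_comp.
Proof. by move=> g; exact: aut_inj. Qed.
Lemma aut_compr1 : right_id aut1 aut_comp.
Proof. by move=> g; exact: aut_inj. Qed.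
Lemma aut_compV : left_inverse aut1 aut_opp aut_comp.
Proof. by move=> g; apply: aut_inj => x /=; rewrite aut_funK. Qed.
Lemma aut_comprV : right_inverse aut1 aut_opp aut_comp.
Proof. by move=> g; apply: aut_inj => x /=; rewrite aut_invK. Qed.

HB.instance Definition _ := isGroup.Build aut
  aut_compA aut_comp1 aut_compr1 aut_compV aut_comprV.

(* The permutation topology: pointwise convergence on the discrete set VT. *)
Definition aut_ptws (g : aut) : {ptws T -> discrete_topology T} := g.

HB.instance Definition _ :=
  Topological.copy aut (initial_topology aut_ptws).

(* Closedness is taken in the topology induced on H. *)
Definition closed_subgroup_of (H N : set aut) :=
  [/\ group_closed [in N], N `<=` H & closed (N : set (subspace H))].

Definition normalizes (H N : set aut) :=
  forall h, H h -> [set n ^ h | n in N] = N.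

Definition topologically_simple (H : set aut) :=
  forall N, closed_subgroup_of H N -> normalizes H N -> N = [set 1] \/ N = H.

(* The underlying vertex set of a subtree; since T has no cycles, a connected
   subgraph of T is the subgraph induced on its vertices. The empty set is
   included. *)
Definition subtree (S : set T) :=
  forall x y, S x -> S y ->
    exists p : seq T, [/\ path adj x p, last x p = y & [set` p] `<=` S].

Definition invariant_under (G : set aut) (S : set T) :=
  forall g, G g -> g @` S = S.

Definition ray (r : nat -> T) :=
  injective r /\ forall i, adj (r i) (r i.+1).

Definition ray_equiv (r s : nat -> T) :=
  exists2 t, ray t & range r `&` range s = range t.

Definition is_end (E : set (nat -> T)) :=
  exists2 r, ray r & E = [set s | ray s /\ ray_equiv r s].

Definition fixes_end (G : set aut) (E : set (nat -> T)) :=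
  forall g, G g -> [set g \o r | r in E] = E.

Definition component (e : rel T) (x : T) : set T :=
  [set y | exists2 p, path e x p & last x p = y].

Definition del_edge (x y : T) : rel T :=
  [rel u v | [&& adj u v, (u, v) != (x, y) & (u, v) != (y, x)]].

(* The other component of T minus the edge is obtained by exchanging x and
   y. *)
Definition half_tree (X : set T) :=
  exists x y : T, [/\ adj x y,
    infinite_set (component (del_edge x y) x),
    infinite_set (component (del_edge x y) y) &
    X = component (del_edge x y) x].

Definition pointwise_stab (G : set aut) (X : set T) : set aut :=
  [set g | G g /\ forall v, X v -> g v = v].

Definition property_H (G : set aut) :=
  forall X, half_tree X -> pointwise_stab G X <> [set 1].

Definition generated_subgroup (A : set aut) : set aut :=
  smallest (fun H : set aut => group_closed [in H]) A.

Definition Gplusplus (G : set aut) : set aut :=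
  closure (generated_subgroup (\bigcup_(X in half_tree) pointwise_stab G X)).

End Aut.

(* Main.v *)
Require Import Defs.
From HB Require Import structures.
From mathcomp Require Import all_boot.
From mathcomp Require Import all_classical.
From mathcomp Require Import topology.

(** Cutting [T] along an edge gives two sides. Call a set of automorphisms
   displacing if every side is mapped into its complement by one of them. A
   minimal group without a fixed end is displacing ([minimal_displacing]):
   otherwise the translates of some side meet pairwise, so that either their
   intersection is a proper invariant subtree or they all contain a common end,
   which is then fixed.

   Displacement is inherited. If [N] is normalized by a displacing group and
   contains one element displacing one side, conjugation provides elements of [N]
   displacing all sides ([displacing_normal]). Property H supplies non-trivial
   elements fixing half-trees, hence vertices with three neighbours, and where
   branching occurs every non-trivial automorphism displaces some side
   ([branch_displaces]). So displacement passes from [G] to the group generated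
   by the stabilizers of half-trees, and from it to every non-trivial [N] that it
   normalizes.

   Finally let [g] fix a half-tree pointwise and let [Y] be the complement. By
   property H the half-tree contains two disjoint branches, and by ping-pong
   between them some [n] in [N] has the property that [n Y], [n^2 Y], ... all
   avoid [Y]. The conjugates [n^i g n^-i] have disjoint supports, and their
   infinite product [f] satisfies [f = g (n f n^-1)] ([swindle_limit]). Thus [g]
   is a commutator of [f] and [n]; since [f] lies in [Gplusplus G], which
   normalizes [N], it follows that [g] is in [N] ([half_tree_stab_sub]). As [N] is
   closed it contains [Gplusplus G]. *)

Set Implicit Arguments.
Unset Strict Implicit.
Unset Printing Implicit Defensive.

Local Open Scope classical_set_scope.
Local Open Scope group_scope.

(** * Automorphisms as a group of functions *)

Section Group.
Variable T : tree.
Implicit Types (g h : aut T) (H : set (aut T)).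

Lemma autME g h v : (g * h) v = g (h v). Proof. by []. Qed.

Lemma autK g : cancel g (g^-1)%g. Proof. exact: aut_funK. Qed.

Lemma autVK g : cancel (g^-1)%g g. Proof. exact: aut_invK. Qed.

Lemma autI g : injective g. Proof. exact: can_inj (autK g). Qed.

Lemma group_closedP H : group_closed [in H] <->
  [/\ H 1, forall g h, H g -> H h -> H (g * h) & forall g, H g -> H g^-1].
Proof.
split=> [Hg|[H1 HM HV]].
  split; first by case: Hg; rewrite inE.
  - by move=> g h Hh Hk; rewrite -in_setE; apply: (group_closedM Hg);
      rewrite in_setE.
  - by move=> g Hh; rewrite -in_setE; apply: (group_closedV Hg);
      rewrite in_setE.
split; first by rewrite inE.
by move=> g h; rewrite !inE => Hh Hk; apply: HM => //; exact: HV.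
Qed.

End Group.

(** * The two sides of an edge *)

Section Sides.
Variable T : tree.
Implicit Types (x y u v w z : T) (D C : set T).

(** For adjacent [x] and [y]; a half-tree only when it and its complement
   [side y x] are infinite. *)
Definition side x y : set T := component (del_edge x y) x.

Lemma adj_neq x y : adj x y -> x <> y.
Proof. by move=> xy E; move: xy; rewrite E adj_irr. Qed.

Lemma side_self x y : side x y x.
Proof. by exists [::]. Qed.

Lemma side_step x y u v :
  side x y u -> adj u v -> (u, v) <> (x, y) -> (u, v) <> (y, x) -> side x y v.
Proof.
move=> [p ep <-] uv /eqP n1 /eqP n2; exists (rcons p v);
  last by rewrite last_rcons.
by rewrite rcons_path ep /del_edge /= uv n1 n2.
Qed.

(** The only place where acyclicity enters: a path from [x] to [y] avoiding
   their edge would close up, with that edge, to a cycle of length at least 3. *)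
Lemma side_far x y : adj x y -> ~ side x y y.
Proof.
move=> xy [p ep lp]; case/shortenP: ep lp => p' ep' Up' _ lp.
have adjp : path adj x p' by apply: sub_path ep' => u v /and3P[].
have : ucycle adj (x :: p').
  by rewrite /ucycle Up' /= rcons_path adjp lp adj_sym xy.
move/tree_acyclic; case: p' ep' lp {adjp Up'} => [|z [|//]] /=.
  by move=> _ E; case: (adj_neq xy).
by rewrite andbT => + E; rewrite E /del_edge /= eqxx andbF.
Qed.

(** Induction over the connected set [side x y], started at any of its
   vertices rather than at [x]. *)
Lemma side_conn C x y z : side x y z -> C z ->
  (forall u v, side x y u -> side x y v -> adj u v -> C u -> C v) ->
  side x y `<=` C.
Proof.
move=> sz Cz CS.
have key u p : side x y u -> path (del_edge x y) u p -> C u <-> C (last u p).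
  elim: p u => [|v p IH] u su //= /andP[/and3P[uv /eqP n1 /eqP n2] ep].
  have sv : side x y v by apply: side_step su uv _ _.
  rewrite -(IH v sv ep); split; first exact: CS.
  by apply: CS => //; rewrite adj_sym.
have Cx : C x by case: sz => p ep lp; apply/(key x p (side_self x y) ep);
  rewrite lp.
by move=> v [p ep <-]; apply/(key x p (side_self x y) ep).
Qed.

Lemma tree_ind C z :
  C z -> (forall u v, adj u v -> C u -> C v) -> forall v, C v.
Proof.
move=> Cz CS v; have [p ep <-] := tree_connected z v.
by elim: p z Cz ep => //= u p IH z Cz /andP[zu]; apply: IH; exact: CS zu Cz.
Qed.

Lemma side_cover x y v : adj x y -> side x y v \/ side y x v.
Proof.
move=> xy; move: v; apply: (@tree_ind _ x); first by left; exact: side_self.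
move=> u v uv [] su.
- have [[_ ->]|n1] := pselect ((u, v) = (x, y)); first by right;
    exact: side_self.
  have [[_ ->]|n2] := pselect ((u, v) = (y, x)); first by left;
    exact: side_self.
  by left; exact: side_step su uv n1 n2.
- have [[_ ->]|n1] := pselect ((u, v) = (x, y)); first by right;
    exact: side_self.
  have [[_ ->]|n2] := pselect ((u, v) = (y, x)); first by left;
    exact: side_self.
  by right; exact: side_step su uv n2 n1.
Qed.

Lemma side_opp x y v : adj x y -> side x y v -> ~ side y x v.
Proof.
move=> xy sv sv'; have yx : adj y x by rewrite adj_sym.
apply: (side_far xy).
suff /(_ y) : side y x `<=` side x y by apply; exact: side_self.
apply: (side_conn sv' sv) => u w su sw uw s; apply: (side_step s uw).
- by move=> [E _]; rewrite E in su; exact: (side_far yx).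
- by move=> [_ E]; rewrite E in sw; exact: (side_far yx).
Qed.

Lemma side_oppN x y v : adj x y -> ~ side x y v -> side y x v.
Proof. by move=> xy ns; case: (side_cover v xy). Qed.

(** A side has a single boundary edge. This replaces most arguments with
   geodesics: a path leaves a side only through that edge. *)
Lemma side_cross x y u v :
  adj x y -> side x y u -> ~ side x y v -> adj u v -> u = x /\ v = y.
Proof.
move=> xy su nsv uv.
have [[-> ->]//|n1] := pselect ((u, v) = (x, y)).
have [[E _]|n2] := pselect ((u, v) = (y, x)).
  by rewrite E in su; case: (side_far xy).
by case: nsv; exact: side_step su uv n1 n2.
Qed.

(** A side is connected, so it cannot meet both sides of an edge that it does
   not contain. *)
Lemma side_avoid x y a b : adj a b -> ~ (side x y a /\ side x y b) ->
  side x y `<=` side a b \/ side x y `<=` side b a.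
Proof.
move=> ab nab; have ba : adj b a by rewrite adj_sym.
have [s|s] := side_cover x ab; [left|right];
  apply: (side_conn (side_self x y) s) => u v su sv uv s';
  apply: contrapT => /(side_cross _ s') []// E1 E2;
  by apply: nab; rewrite -E1 -E2.
Qed.

(** Two edges never cross: one side of the first is contained in one side of the
   second, because the second edge lies on a single side of the first. *)
Lemma side_nested x y a b : adj x y -> adj a b ->
  [\/ side x y `<=` side a b, side x y `<=` side b a,
      side y x `<=` side a b | side y x `<=` side b a].
Proof.
move=> xy ab; have [[sa sb]|nab] := pselect (side x y a /\ side x y b).
  have [[sa' _]|nab] := pselect (side y x a /\ side y x b).
    by case: (side_opp xy sa).
  by case: (side_avoid ab nab) => ?; [constructor 3|constructor 4].
by case: (side_avoid ab nab) => ?; [constructor 1|constructor 2].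
Qed.

(** The branches at a vertex [v] are the sides [side u v], for [u] a neighbour
   of [v]; they are pairwise disjoint. *)
Lemma side_branch u w v z :
  adj u v -> adj w v -> u <> w -> side u v z -> ~ side w v z.
Proof.
move=> uv wv uw; move: z.
apply: (side_conn (side_self u v)) => [s|a b sa sb ab na s].
  by have [] := side_cross wv s (side_far wv) uv.
have ba : adj b a by rewrite adj_sym.
have [_ E] := side_cross wv s na ba.
by rewrite E in sa; apply: (side_far uv).
Qed.

Lemma side_away u v w : adj v u -> adj v w -> u <> w ->
  side u v `<=` side v w.
Proof.
move=> vu vw uw z sz; apply: side_oppN; first by rewrite adj_sym.
by apply: side_branch sz => //; rewrite adj_sym.
Qed.

(** The first step of a simple path from [v] to [z]: the rest of the path does
   not return to [v], hence stays in one branch. *)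
Lemma side_dir v z : z <> v -> exists2 u, adj v u & side u v z.
Proof.
have [p ep <-] := tree_connected v z.
case/shortenP: ep => -[|u q] //= /andP[vu eq] /andP[vq _] _ _.
exists u => //; exists q => //.
move: eq; apply: sub_in_path (allss _) => a b aq bq /= ab.
have av : a != v by apply: contraNneq vq => <-; rewrite inE in aq.
have bv : b != v by apply: contraNneq vq => <-; rewrite inE in bq.
by rewrite /del_edge /= ab !xpair_eqE (negPf av) (negPf bv) andbF.
Qed.

(** A path leaving a side and coming back uses the boundary edge twice, so it
   repeats a vertex. Hence sides are convex. *)
Lemma uniq_path_side x y u p : adj x y -> side x y u -> path adj u p ->
  uniq (u :: p) -> side x y (last u p) -> [set` p] `<=` side x y.
Proof.
move=> xy; elim: p u => [|v p IH] u su; first by move=> _ _ _ z.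
move=> /= /andP[uv ep] /andP[up Up] sl.
have [sv|nsv] := pselect (side x y v).
  move=> z /=; rewrite inE => /orP[/eqP->//|]; exact: IH ep Up sl z.
have [ux _] := side_cross xy su nsv uv.
suff xp : x \in v :: p by rewrite ux xp in up.
elim: p v nsv ep sl {IH uv up Up} => [|w p IH] v nsv //= /andP[vw ep] sl.
have [sw|nsw] := pselect (side x y w); last by rewrite inE (IH w) ?orbT.
have wv : adj w v by rewrite adj_sym.
by have [-> _] := side_cross xy sw nsv wv; rewrite !inE eqxx orbT.
Qed.

Lemma side_aut (g : aut T) x y v : adj x y ->
  side (g x) (g y) (g v) <-> side x y v.
Proof.
have imp (h : aut T) a b w : adj a b -> side a b w -> side (h a) (h b) (h w).
  move=> ab; move: w; apply: (side_conn (side_self a b));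
    first exact: side_self.
  move=> u w su sw uw s; apply: contrapT => ns.
  have [] := side_cross _ s ns; rewrite ?aut_adj // => _ /(@autI _ h) E.
  by rewrite E in sw; apply: (side_far ab).
move=> xy; split; last exact: imp.
move=> /(imp (g^-1)); rewrite aut_adj => /(_ xy).
by rewrite !autK.
Qed.

End Sides.

(** * Flows towards an end *)

Section Flow.
(** A map [d] moving every vertex to a neighbour, as if one step closer to a
   fixed end: it never turns back, and each edge is traversed in one of its two
   directions. *)
Variables (T : tree) (d : T -> T).
Hypothesis d_adj : forall v, adj v (d v).
Hypothesis d_forth : forall v, d (d v) <> v.
Hypothesis d_edge : forall v w, adj v w -> d v = w \/ d w = v.

(** The orbit of [v] enters the side [side (d v) v] at once and cannot leave it
   again without turning back at its boundary edge. *)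
Lemma flow_no_return v n : iter n.+1 d v <> v.
Proof.
have dv : adj (d v) v by rewrite adj_sym d_adj.
suff : side (d v) v (iter n.+1 d v).
  by move=> + E; rewrite E; exact: side_far.
elim: n => [|n IH]; first exact: side_self.
apply: contrapT => ns.
have [E1 E2] := side_cross dv IH ns (d_adj _).
by apply: (@d_forth v); rewrite -E1 -[RHS]E2.
Qed.

Lemma flow_ray v : ray (fun i => iter i d v).
Proof.
split=> [i j|i]; last exact: d_adj.
wlog ij : i j / i <= j.
  by move=> W E; case: (leqP i j) => [/W->//|/ltnW/W->].
rewrite -(subnK ij) iterD; case: (j - i) => // n E.
by case: (@flow_no_return (iter i d v) n); rewrite -E.
Qed.

Lemma flow_merge v w : exists a b, iter a d v = iter b d w.
Proof.
move: w; apply: (@tree_ind _ _ v); first by exists 0, 0.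
move=> w w' ww' [a [b E]]; have [dw|dw] := d_edge ww'.
  by exists a.+1, b; rewrite iterS E -iterS iterSr dw.
by exists a, b.+1; rewrite iterSr dw.
Qed.

Lemma flow_iter (s : nat -> T) : (forall i, s i.+1 = d (s i)) ->
  forall j i, s (i + j) = iter j d (s i).
Proof. by move=> sd; elim=> [|j IH] i; rewrite ?addn0 // addnS sd IH. Qed.

(** The end to which [d] points consists exactly of the rays that follow [d] from
   their very start. A ray that disobeys [d] once runs against it forever after,
   as it may not turn back; but following [d] from one of its later vertices
   leads back along it, so it can meet an orbit of [d] only finitely often. *)
Lemma flow_equivP v0 (s : nat -> T) : ray s ->
  ray_equiv (fun i => iter i d v0) s <-> forall i, s i.+1 = d (s i).
Proof.
set r := fun i => _; have [r_inj r_adj] := flow_ray v0.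
move=> [s_inj s_adj]; split=> [[t [t_inj _] rst]|sd].
  apply: contrapT => /existsNP[i0 ni0].
  have back m : d (s (i0 + m).+1) = s (i0 + m).
    elim: m => [|m IH].
      by rewrite addn0; case: (d_edge (s_adj i0)) => // E; case: ni0.
    case: (d_edge (s_adj (i0 + m.+1))) => // E.
    by move: E; rewrite addnS IH => /s_inj/eqP;
      rewrite -addn2 -{1}[(i0 + m)%N]addn0 eqn_add2l.
  have iback m : iter m d (s (i0 + m)) = s i0.
    by elim: m => [|m IH]; rewrite ?addn0 // iterSr addnS back.
  have {}iback j k : i0 <= j -> s j = r k -> r (j - i0 + k) = s i0.
    by move=> /subnKC ij sr; rewrite -[RHS](iback (j - i0)) ij sr /r iterD.
  have tsr k : exists2 j, t k = s j & exists k', s j = r k'.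
    have : (range r `&` range s) (t k) by rewrite rst; exists k.
    by move=> [[k' _ rk] [j _ sj]]; exists j => //; exists k'; rewrite sj.
  (* A common vertex [s j] with [i0 <= j] lies [j - i0] steps before [s i0] on
     [r]; so if [s i0] is at position [K] on [r], then [j] is at most [i0 + K]. *)
  have [n tn] : exists n, forall k, exists j : 'I_n, t k = s j.
    have [[K rK]|nK] := pselect (exists K, r K = s i0).
      exists (i0 + K).+1 => k; have [j tj [k' jk]] := tsr k.
      suff jn : j < (i0 + K).+1 by exists (Ordinal jn).
      rewrite ltnS; have [/ltnW ji|ij] := ltnP j i0.
        by rewrite (leq_trans ji) ?leq_addr.
      have := iback _ _ ij jk; rewrite -rK => /r_inj <-.
      by rewrite addnA subnKC // leq_addr.
    exists i0 => k; have [j tj [k' jk]] := tsr k.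
    have [ji|ij] := ltnP j i0; first by exists (Ordinal ji).
    by case: nK; exists (j - i0 + k'); exact: iback.
  have [f tf] := choice tn.
  suff /leq_card : injective (fun i : 'I_n.+1 => f i) by rewrite !card_ord ltnn.
  by move=> i j E; apply/val_inj/t_inj; rewrite !tf E.
have [a [b ab]] := flow_merge v0 (s 0).
have ex : exists b, `[< range s (r b) >].
  by exists a; apply/asboolP; exists b => //;
    rewrite -[b in LHS]add0n (flow_iter sd).
case: (ex_minnP ex) => {a ab}b /asboolP[c _ sc] bmin.
exists (fun i => r (b + i)).
  by split=> [i j /r_inj/addnI//|i]; rewrite addnS; exact: r_adj.
apply/seteqP; split=> [_ [[j _ <-] sj]|_ [i _ <-]].
  have bj : b <= j by apply: bmin; apply/asboolP.
  by exists (j - b) => //; rewrite subnKC.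
split; first by exists (b + i).
by exists (c + i) => //; rewrite (flow_iter sd) sc /r addnC iterD.
Qed.

(** The description of the end in [flow_equivP] is visibly invariant under the
   automorphisms that commute with [d]. *)
Lemma flow_fixed_end (G : set (aut T)) (v0 : T) : group_closed [in G] ->
  (forall g v, G g -> d (g v) = g (d v)) -> exists2 E, is_end E & fixes_end G E.
Proof.
move=> /group_closedP[_ _ GV] dG.
exists [set s | ray s /\ forall i, s i.+1 = d (s i)].
  exists (fun i => iter i d v0); first exact: flow_ray.
  by apply/seteqP; split=> s [rs]; move=> /(flow_equivP v0 rs).
have fwd g s : G g -> ray s /\ (forall i, s i.+1 = d (s i)) ->
    ray (g \o s) /\ (forall i, (g \o s) i.+1 = d ((g \o s) i)).
  move=> Gg [[s_inj s_adj] sd]; split; last by move=> i /=; rewrite sd dG.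
  by split=> [i j /autI/s_inj//|i]; rewrite /= aut_adj.
move=> g Gg; apply/seteqP; split=> [_ [s Es <-]|s Es]; first exact: fwd.
exists ((g^-1)%g \o s); first exact: fwd (GV _ Gg) Es.
by apply/funext => i /=; rewrite autVK.
Qed.

End Flow.

(** * Groups that push every side off itself *)

Section Displacing.
Variable T : tree.
Implicit Types (x y u v w z : T) (g h m n : aut T) (H N : set (aut T)).

Definition displaces g x y := forall v, side x y v -> side y x (g v).

(** This single condition stands for both absence of a proper invariant subtree
   and absence of a fixed end; unlike these, it passes easily to normalized
   subgroups, see [displacing_normal]. *)
Definition displacing H := forall x y, adj x y ->
  exists2 h, H h & displaces h x y.

(** If no element of [G] displaces the side [D] of [x], then the translates of [D]
   meet pairwise. Their intersection is an invariant subtree, and it misses [y],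
   so it must be empty. Then each vertex [v] lies outside some translate, and the
   first step from [v] towards that translate does not depend on the translate,
   because any two of them meet. These first steps form a [G]-equivariant flow,
   whose end is fixed by [G]. *)
Lemma minimal_displacing (G : set (aut T)) : group_closed [in G] ->
  (forall S : set T, subtree S -> S !=set0 -> invariant_under G S -> S = setT) ->
  (forall E, is_end E -> ~ fixes_end G E) ->
  displacing G.
Proof.
move=> Ggrp Gmin Gend x y xy; have [G1 GM GV] := (group_closedP G).1 Ggrp.
apply: contrapT => nodisp.
have meet g : G g -> exists2 v, side x y v & side x y (g v).
  move=> Gg; apply: contrapT => nv; apply: nodisp; exists g => // v sv.
  by apply: side_oppN => // sgv; apply: nv; exists v.
have pull (g : aut T) : adj (g^-1%g x) (g^-1%g y) /\
    forall z, side x y (g z) <-> side (g^-1%g x) (g^-1%g y) z.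
  have adjg : adj (g^-1%g x) (g^-1%g y) by rewrite aut_adj.
  by split=> // z; have := side_aut g z adjg; rewrite !autVK.
(* The preimages of the side under the elements of [G] serve as its
   translates. *)
pose I := [set v | forall g : aut T, G g -> side x y (g v)].
have [[v Iv]|nI] := pselect (I !=set0).
  suff IT : I = setT.
    by apply: (side_far xy); have /(_ 1 G1) : I y by rewrite IT.
  apply: Gmin; last 2 first.
  - by exists v.
  - move=> h Gh; apply/seteqP; split=> [_ [z Iz <-] g Gg|z Iz].
      by rewrite -autME; apply: Iz; exact: GM.
    exists (h^-1%g z); last by rewrite autVK.
    by move=> g Gg; rewrite -autME; apply: Iz; apply: GM => //; exact: GV.
  move=> a b Ia Ib; have [p ep lp] := tree_connected a b.
  case/shortenP: ep lp => q eq Uq _ lq; exists q; split=> // z zq g Gg.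
  have [adjg /(_ _)sg] := pull g; apply/sg.
  by apply: (uniq_path_side adjg _ eq Uq) zq; apply/sg; rewrite ?lq;
    [exact: Ia|exact: Ib].
have off v : exists2 g : aut T, G g & ~ side x y (g v).
  apply: contrapT => nv; apply: nI; exists v => g Gg.
  by apply: contrapT => sg; apply: nv; exists g.
(* [R v u]: the neighbour [u] of [v] is the first step from [v] towards some
   translate that avoids [v]. *)
pose R v u := adj v u /\
  exists2 g : aut T, G g & forall z, side x y (g z) -> side u v z.
have Rex v g : G g -> ~ side x y (g v) ->
    exists2 u, adj v u & forall z, side x y (g z) -> side u v z.
  move=> Gg; have [adjg sg] := pull g; move=> /sg nv.
  have [u vu su] : exists2 u, adj v u & side u v (g^-1%g x).
    by apply: side_dir => E; apply: nv; rewrite -E; exact: side_self.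
  exists u => // z /sg; apply: (side_conn (side_self _ _) su) => a b sa sb ab s.
  apply: contrapT => ns; have uv : adj u v by rewrite adj_sym.
  by have [_ E] := side_cross uv s ns ab; apply: nv; rewrite -E.
have Rtot v : exists u, R v u.
  by have [g Gg /(Rex v g Gg)[u vu su]] := off v; exists u; split=> //;
    exists g.
have Rmeet u v a b : R v u -> R b a -> exists2 z, side u v z & side a b z.
  move=> [_ [g Gg sg]] [_ [h Gh sh]].
  have [z s1 s2] := meet _ (GM _ _ Gh (GV _ Gg)).
  by exists (g^-1%g z); [apply: sg; rewrite autVK|apply: sh].
have Rfun v u w : R v u -> R v w -> u = w.
  move=> Ru Rw; have [z su sw] := Rmeet _ _ _ _ Ru Rw; apply: contrapT => uw.
  by case: Ru Rw => uv _ [wv _]; apply: (side_branch _ _ uw su sw);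
    rewrite adj_sym.
have [d dR] := choice Rtot.
have [E] : exists2 E, is_end E & fixes_end G E; last exact: Gend.
apply: (@flow_fixed_end _ d) => //; first by move=> v; case: (dR v).
- move=> v E; have := dR (d v); rewrite E => Rv.
  have [z s1 s2] := Rmeet _ _ _ _ (dR v) Rv.
  by apply: side_opp s1 s2; rewrite adj_sym; case: (dR v).
- move=> v w vw; have [g Gg ng] := off v.
  have [u vu su] := Rex v g Gg ng.
  have [uw|uw] := pselect (u = w).
    by left; apply: (Rfun v) => //; split=> //; exists g => // z; rewrite -uw;
      exact: su.
  right; apply: (Rfun w) => //; split; first by rewrite adj_sym.
  by exists g => // z /su; exact: side_away.
- move=> g v Gg; apply: (Rfun (g v)) => //.
  have [vd [h Gh sh]] := dR v; split; first by rewrite aut_adj.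
  exists (h * g^-1)%g; first by apply: GM => //; exact: GV.
  have dv : adj (d v) v by rewrite adj_sym.
  by move=> z; rewrite autME => /sh; rewrite -(side_aut g) // autVK.
Qed.

Lemma aut_neq1 g : g <> 1 -> exists v, g v <> v.
Proof.
move=> gn1; apply: contrapT => nv; apply/gn1/aut_inj => v.
by apply: contrapT => gv; apply: nv; exists v.
Qed.

(** On the way from a fixed vertex to a moved one, some fixed vertex [z] has a
   moved neighbour [w]. The extra fixed neighbour [t] makes [z] a branching
   vertex, with the three neighbours [t], [w] and [g w]. *)
Lemma exists_fork g u v : g u = u -> g v <> v ->
  (exists2 t, adj t u & g t = t) ->
  exists t z w, [/\ adj t z, adj w z, g t = t, g z = z & g w <> w].
Proof.
move=> gu gv tu; apply: contrapT => nfork.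
suff [] : g v = v /\ exists2 t, adj t v & g t = t by [].
move: v {gv}; apply: (@tree_ind _ _ u); first by [].
move=> z w zw [gz [t tz gt]].
split; last by exists z.
apply: contrapT => gw; apply: nfork; exists t, z, w; split=> //.
by rewrite adj_sym.
Qed.

Lemma fork_displaces g z w : adj w z -> g z = z -> g w <> w -> displaces g w z.
Proof.
move=> wz gz gw v sv; apply: side_oppN => // sgv.
have gwz : adj (g w) z by rewrite -gz aut_adj.
apply: (side_branch gwz wz gw _ sgv).
by rewrite -[z in side _ z]gz side_aut.
Qed.

(** If [c] is fixed, then some fixed vertex has a moved neighbour, since otherwise
   all vertices would be fixed, and the branch of that neighbour is displaced. If
   [c] is moved, each of [g c] and [g^-1 c] lies in at most one branch at [c], so
   one of the three branches contains neither. Neither [g] nor its inverse maps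
   that branch into itself, so [g] displaces it. *)
Lemma branch_displaces g c u1 u2 u3 :
  adj u1 c -> adj u2 c -> adj u3 c -> u1 <> u2 -> u1 <> u3 -> u2 <> u3 ->
  g <> 1 -> exists w z, adj w z /\ displaces g w z.
Proof.
move=> a1 a2 a3 n12 n13 n23 /aut_neq1[v gv].
have [gc|gc] := pselect (g c = c).
  apply: contrapT => nd.
  have nbr u : adj u c -> g u = u.
    move=> uc; apply: contrapT => gu; apply: nd; exists u, c; split=> //.
    exact: fork_displaces.
  have [] := exists_fork gc gv; first by exists u1 => //; exact: nbr.
  move=> t [z [w [_ wz _ gz gw]]]; apply: nd; exists w, z; split=> //.
  exact: fork_displaces.
have gVc : g^-1%g c <> c by move=> E; apply: gc; rewrite -{1}E autVK.
have [u [uc n1 n2]] : exists u,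
    [/\ adj u c, ~ side u c (g c) & ~ side u c (g^-1%g c)].
  have [|/contrapT s1] := pselect (~ (side u1 c (g c) \/ side u1 c (g^-1%g c))).
    by move=> /not_orP[]; exists u1.
  have [|/contrapT s2] := pselect (~ (side u2 c (g c) \/ side u2 c (g^-1%g c))).
    by move=> /not_orP[]; exists u2.
  exists u3; split=> // s3; case: s1 s2 => s1 [] s2;
    first [exact: (side_branch a1 a2 n12 s1 s2)
          |exact: (side_branch a1 a3 n13 s1 s3)
          |exact: (side_branch a2 a3 n23 s2 s3)].
exists u, c; split=> // v' sv'; apply: side_oppN => // sgv.
have gcu : adj (g u) (g c) by rewrite aut_adj.
have ngu : ~ side u c (g u).
  by move=> s; have [_] := side_cross uc s n1 gcu.
have [sub|sub] := side_avoid gcu (fun s => ngu s.1 : False).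
  have su : side u c (g^-1%g u).
    by rewrite -(side_aut g) // autVK; apply: sub (side_self u c).
  have gVuc : adj (g^-1%g u) (g^-1%g c) by rewrite aut_adj.
  by have [_] := side_cross uc su n2 gVuc.
by apply: (side_opp gcu _ (sub _ sgv)); rewrite side_aut.
Qed.

(** As [N] is stable under conjugation by [H], it suffices to move a given side
   into the one displaced by [n] by means of [H]. In each of the four relative
   positions of two edges this takes at most two displacements. *)
Lemma displacing_normal H N : group_closed [in H] -> displacing H ->
  (forall h n, H h -> N n -> N (n ^ h)) ->
  (exists n x y, [/\ N n, adj x y & displaces n x y]) -> displacing N.
Proof.
move=> /group_closedP[H1 HM _] Hd NJ [n [a [b [Nn ab nd]]]] x y xy.
have ba : adj b a by rewrite adj_sym.
have [h Hh hs] : exists2 h, H h & forall v, side x y v -> side a b (h v).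
  have [p Hp ps] := Hd x y xy; have [q Hq qs] := Hd b a ba.
  have [s|s|s|s] := side_nested xy ab.
  - by exists 1 => // v /s.
  - by exists q => // v /s/qs.
  - by exists p => // v /ps/s.
  - by exists (q * p)%g => [|v /ps/s/qs //]; exact: HM.
exists (n ^ h); first exact: NJ.
move=> v sv; apply: side_oppN => // /hs.
by rewrite conjgE !autME autVK; apply: side_opp => //; exact/nd/hs.
Qed.

(** First throw the complement of [side a b] into [side a b], which avoids
   [side c e], and then throw the complement of [side c e] into [side c e]. *)
Lemma displacing_ping_pong N a b c e : group_closed [in N] -> displacing N ->
  adj a b -> adj c e -> (forall v, side a b v -> ~ side c e v) ->
  exists2 n, N n & forall v, ~ side a b v -> side c e (n v).
Proof.
move=> /group_closedP[_ NM _] Nd ab ce dis.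
have ba : adj b a by rewrite adj_sym.
have ec : adj e c by rewrite adj_sym.
have [p Np ps] := Nd b a ba; have [q Nq qs] := Nd e c ec.
exists (q * p)%g; first exact: NM.
by move=> v /(side_oppN ab)/ps/dis/(side_oppN ce)/qs.
Qed.

End Displacing.

(** * Limits and an infinite product *)

Section Limits.
Variable T : tree.
Implicit Types (v x y : T) (g h m n : aut T).

(** A pointwise limit of automorphisms need not be surjective; stabilization of
   the inverses provides the inverse of the limit. *)
Lemma aut_limit (f : nat -> aut T) :
  (forall v, exists w K, forall k, K <= k -> f k v = w) ->
  (forall v, exists w K, forall k, K <= k -> (f k)^-1%g v = w) ->
  exists g : aut T, forall v, exists K, forall k, K <= k -> f k v = g v.
Proof.
move=> /choice[l lP] /choice[l' lP'].
have lK : cancel l l'.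
  move=> v; have [K fv] := lP v; have [K' fv'] := lP' (l v).
  by rewrite -(fv' _ (leq_maxr K K')) -(fv _ (leq_maxl K K')) autK.
have lVK : cancel l' l.
  move=> v; have [K fv] := lP' v; have [K' fv'] := lP (l' v).
  by rewrite -(fv' _ (leq_maxr K K')) -(fv _ (leq_maxl K K')) autVK.
have ladj : {mono l : x y / adj x y}.
  move=> x y; have [K fx] := lP x; have [K' fy] := lP y.
  by rewrite -(fx _ (leq_maxl K K')) -(fy _ (leq_maxr K K')) aut_adj.
by exists (Aut lK lVK ladj).
Qed.

Lemma closure_limit (A : set (aut T)) (f : nat -> aut T) g :
  (forall k, A (f k)) -> (forall v, exists K, forall k, K <= k -> f k v = g v) ->
  closure A g.
Proof.
move=> Af fg.
have cvf : (fun k => aut_ptws (f k)) @ \oo --> aut_ptws g.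
  apply/cvg_sup => v.
  move=> U /= [_ [[C _ <-] gC] CU]; have [K fK] := fg v.
  by exists K => // k Kk; apply: CU; rewrite /= /aut_ptws fK.
move=> B /= [_ [[C Cop <-] gC] CB].
have [K _ CK] : nbhs (aut_ptws (f K) @[K --> \oo]) C.
  by apply: cvf; apply: open_nbhs_nbhs; split.
exists (f K); split; first exact: Af.
by apply/CB/CK => /=.
Qed.

(** The product of the conjugates [n^i g n^-i] for [i < k], in the recursive form
   that makes the functional equation of [swindle_limit] pass to the limit. *)
Fixpoint swindle g n k : aut T :=
  if k is k'.+1 then g * (n * swindle g n k' * n^-1) else 1.

Lemma swindleS g n k v :
  swindle g n k.+1 v = g (n (swindle g n k (n^-1%g v))).
Proof. by []. Qed.

Lemma swindleVS g n k v :
  (swindle g n k.+1)^-1%g v = n ((swindle g n k)^-1%g (n^-1%g (g^-1%g v))).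
Proof.
rewrite -[swindle g n k.+1]/(g * (n * swindle g n k * n^-1))%g !invgM invgK.
by [].
Qed.

(** The conjugates [n^i g n^-i] have the pairwise disjoint supports [n^i Y], so
   their infinite product [f] makes sense. Removing the first factor from the
   product is the same as conjugating it by [n], which is the equation: it shows
   that [g] is the commutator of [f] and [n]. *)
Lemma swindle_limit g n (Y : set T) :
  (forall v, ~ Y v -> g v = v) -> (forall v i, Y v -> ~ Y (iter i.+1 n v)) ->
  exists2 f : aut T, f = g * (n * f * n^-1) &
    forall v, exists K, forall k, K <= k -> swindle g n k v = f v.
Proof.
move=> gY nY.
have gVY v : ~ Y v -> g^-1%g v = v by move=> /gY {1}<-; rewrite autK.
have gVYY v : Y v -> Y (g^-1%g v).
  by move=> Yv; apply: contrapT => /[dup]/gY; rewrite autVK => <-.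
(* [E] is the union of the supports; outside it nothing moves, and stabilization
   on [n^i Y] follows from stabilization on [Y] by induction on [i]. *)
pose E := [set v | exists i w, Y w /\ v = iter i n w].
have YE v : ~ E v -> ~ Y v by move=> nE Yv; apply: nE; exists 0, v.
have EV v : ~ E v -> ~ E (n^-1%g v).
  move=> nE [i [w [Yw vw]]]; apply: nE; exists i.+1, w; split=> //.
  by rewrite iterS -vw autVK.
have EY v : Y v -> ~ E (n^-1%g v).
  move=> Yv [i [w [Yw vw]]]; apply: (nY w i Yw).
  by rewrite iterS -vw autVK.
have out k v : ~ E v -> swindle g n k v = v.
  elim: k v => // k IH v nE; rewrite swindleS IH ?autVK; last exact: EV.
  by apply: gY; exact: YE.
have outV k v : ~ E v -> (swindle g n k)^-1%g v = v.
  by move=> /(out k) {1}<-; rewrite autK.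
have stab v : exists w K, forall k, K <= k -> swindle g n k v = w.
  have [[i [w [Yw ->]]]|nE] := pselect (E v); last first.
    by exists v, 0 => k _; exact: out.
  elim: i => [|i [l [K IH]]].
    exists (g w), 1%N => -[|k] // _; rewrite swindleS out ?autVK //; exact: EY.
  exists (g (n l)), K.+1 => -[|k] //; rewrite ltnS => /IH.
  by rewrite swindleS iterS autK => ->.
have stabV v : exists w K, forall k, K <= k -> (swindle g n k)^-1%g v = w.
  have [[i [w [Yw ->]]]|nE] := pselect (E v); last first.
    by exists v, 0 => k _; exact: outV.
  elim: i => [|i [l [K IH]]].
    exists (g^-1%g w), 1%N => -[|k] // _.
    rewrite swindleVS outV ?autVK //; exact/EY/gVYY.
  exists (n l), K.+1 => -[|k] //; rewrite ltnS => /IH.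
  rewrite swindleVS gVY iterS ?autK => [->//|]; exact: nY.
have [f fP] := aut_limit stab stabV.
exists f => //; apply: aut_inj => v.
have [K fv] := fP v; have [K' fnv] := fP (n^-1%g v).
rewrite -(fv _ (leq_trans (leq_maxl K K') (leqnSn _))) swindleS !autME.
by rewrite fnv ?leq_maxr.
Qed.

End Limits.

(** * Pointwise stabilizers of half-trees *)

Section HalfTreeStabilizers.
Variable T : tree.
Implicit Types (x y u v w z : T) (g h n f : aut T) (G H N : set (aut T)).

(** A finite side would receive an injective image of its complement, making the
   whole tree finite. *)
Lemma displacing_half_tree G (X : set T) : displacing G -> half_tree X ->
  forall x y, adj x y -> half_tree (side x y).
Proof.
move=> Gd [a [b [ab infa _ _]]].
suff inf x y : adj x y -> infinite_set (side x y).
  move=> x y xy; exists x, y; split=> //; first exact: inf.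
  have -> : del_edge x y = del_edge y x.
    by apply/funext => u; apply/funext => v;
      rewrite /del_edge /= [X in _ && X]andbC.
  by apply: inf; rewrite adj_sym.
move=> xy fin; have yx : adj y x by rewrite adj_sym.
have [h _ hs] := Gd y x yx.
have fin' : finite_set (side y x).
  apply: (@sub_finite_set _ _ (h @^-1` side x y)); first by move=> v /hs.
  by apply: finite_preimage => // u v _ _; exact: autI.
apply: infa; apply: (@sub_finite_set _ _ (side x y `|` side y x)).
  by move=> v _; exact: side_cover.
by rewrite finite_setU.
Qed.

(** Its closure is [Gplusplus G]. Displacement and conjugation are treated in this
   dense subgroup, and only limits of its elements in the closure. *)
Definition stab_group G : set (aut T) :=
  generated_subgroup (\bigcup_(X in @half_tree T) pointwise_stab G X).

Lemma stab_group_closed G : group_closed [in stab_group G].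
Proof.
apply/group_closedP; split.
- by move=> H [/group_closedP[]].
- move=> g h Gg Gh H HP; case: (HP) => /group_closedP[_ HM _] _.
  by apply: HM; [exact: Gg|exact: Gh].
- move=> g Gg H HP; case: (HP) => /group_closedP[_ _ HV] _.
  by apply: HV; exact: Gg.
Qed.

Lemma stab_group_gen G (X : set T) g : half_tree X -> pointwise_stab G X g ->
  stab_group G g.
Proof. by move=> hX gX; apply: sub_gen_smallest; exists X. Qed.

Lemma stab_group_sub G : group_closed [in G] -> stab_group G `<=` G.
Proof. by move=> Gg; apply: smallest_sub => // g [X _ []]. Qed.

Lemma stab_group_conj G : group_closed [in G] ->
  (forall x y, adj x y -> half_tree (side x y)) ->
  forall h g, G h -> stab_group G g -> stab_group G (g ^ h).
Proof.
move=> /group_closedP[_ GM GV] sides h g Gh; move: g.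
have /group_closedP[S1 SM SV] := stab_group_closed G.
apply: smallest_sub.
  apply/group_closedP; split=> /=; first by rewrite conj1g.
  - by move=> g k Sg Sk; rewrite conjMg; exact: SM.
  - by move=> g Sg; rewrite conjVg; exact: SV.
move=> g [_ [x [y [xy _ _ ->]]] [Gg gx]] /=.
apply: (@stab_group_gen _ (side (h^-1%g x) (h^-1%g y))).
  by apply: sides; rewrite aut_adj.
split; first by rewrite conjgE; apply: (GM); [exact: GV|exact: GM].
move=> v; rewrite -(side_aut h) ?aut_adj // !autVK => /gx gv.
by rewrite conjgE !autME gv autK.
Qed.

(** Property H in the form in which it is used: besides fixing a side, the element
   is seen to have a branching vertex among its fixed points. *)
Lemma property_H_fork G x y : group_closed [in G] -> property_H G ->
  half_tree (side x y) -> adj x y ->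
  exists2 g, pointwise_stab G (side x y) g &
    exists t z w, [/\ adj t z, adj w z, g t = t, g z = z & g w <> w].
Proof.
move=> /group_closedP[G1 _ _] GH hxy xy.
have [g [Gg gs] /aut_neq1[v gv]] :
    exists2 g, pointwise_stab G (side x y) g & g <> 1.
  apply: contrapT => ng; apply: (GH _ hxy); apply/seteqP; split=> [g sg|_ ->//].
  by apply: contrapT => gn1; apply: ng; exists g.
exists g => //.
have [t xt st] : exists2 t, adj x t & side x y t.
  have [z sz zx] : exists2 z, side x y z & z <> x.
    apply: contrapT => nz; case: hxy => a [b [_ inf _ E]]; apply: inf.
    rewrite -[component _ _]E; apply: (@sub_finite_set _ _ [set x]) => // z sz.
    by apply: contrapT => zx; apply: nz; exists z.
  have [t xt tz] := side_dir zx; exists t => //; apply: contrapT => nst.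
  have [_ E] := side_cross xy (side_self x y) nst xt.
  by rewrite E in tz; exact: side_opp tz.
apply: (exists_fork (gs x (side_self x y)) gv).
by exists t; [rewrite adj_sym|exact: gs].
Qed.

Lemma Gplusplus_sub G : group_closed [in G] -> closed G -> Gplusplus G `<=` G.
Proof.
move=> Gg Gc; rewrite [X in _ `<=` X](closure_id G).1 //.
by apply: closureS; exact: stab_group_sub.
Qed.

Lemma closed_subspace_of G N : closed G -> N `<=` G ->
  closed (N : set (subspace G)) -> closed N.
Proof. by move=> Gc NG; rewrite -closed_setIS // setIidl. Qed.

(** Let [Y] be the complement of the half-tree [X] fixed by [g]. Property H applied
   to [Y] yields disjoint branches [A] and [B] inside [X], and ping-pong yields
   [n] in [N] mapping the complement of [A] into [B]. The forward iterates of [n]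
   then send [Y] into [B], so that [g] is the commutator of [n] with an infinite
   product [f] in [Gplusplus G]. As this set normalizes [N], the commutator is in
   [N]. *)
Lemma half_tree_stab_sub G N x y : group_closed [in G] -> group_closed [in N] ->
  property_H G -> N `<=` G ->
  (forall x y, adj x y -> half_tree (side x y)) ->
  normalizes (Gplusplus G) N -> displacing N -> adj x y ->
  pointwise_stab G (side x y) `<=` N.
Proof.
move=> Gg Ng GH NG sides nN Nd xy g gst; have [Gg' gs] := gst.
have [_ NM NV] := (group_closedP N).1 Ng.
have yx : adj y x by rewrite adj_sym.
have [a [_ as_] [t [z [w [_ wz _ az aw]]]]] :=
  property_H_fork Gg GH (sides y x yx) yx.
(* Here [A] is [side w z], [B] is its image under [a], and [a] fixes [Y] and
   displaces [A]: this is why [Y] meets neither. *)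
have ad := fork_displaces wz az aw.
have awz : adj (a w) z by rewrite -az aut_adj.
have YA v : side y x v -> ~ side w z v.
  by move=> /as_ av /[dup]/ad; rewrite av => s1 s2; exact: side_opp s2 s1.
have YB v : side y x v -> ~ side (a w) z v.
  move=> Yv; rewrite -(as_ v Yv) -[z in side _ z]az side_aut //; exact: YA.
have AB v : side w z v -> ~ side (a w) z v by apply: side_branch => // /esym.
have [n Nn nAB] := displacing_ping_pong Ng Nd wz awz AB.
have Bn v i : side y x v -> side (a w) z (iter i.+1 n v).
  move=> Yv; elim: i => [|i IH]; first exact/nAB/YA.
  by apply: nAB => /AB.
have [f fE flim] := @swindle_limit _ g n (side y x)
  (fun v nYv => gs v (side_oppN yx nYv)) (fun v i Yv Bv => YB _ Bv (Bn v i Yv)).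
have [S1 SM _] := (group_closedP _).1 (stab_group_closed G).
have [_ _ GV] := (group_closedP G).1 Gg.
have Pf : Gplusplus G f.
  apply: closure_limit flim; elim=> [|k IH]; first exact: S1.
  apply: SM; first exact: stab_group_gen (sides x y xy) gst.
  have := stab_group_conj Gg sides (GV _ (NG _ Nn)) IH.
  by rewrite conjgE invgK mulgA.
have [m Nm mE] : [set n ^ f | n in N] n by rewrite nN.
have -> : g = m * n^-1.
  have -> : m = f * n * f^-1.
    by rewrite -mE conjgE !mulgA mulgV mul1g mulgK.
  by rewrite {1}fE !mulgA !mulgVK ?mulgK.
by apply: NM => //; exact: NV.
Qed.

End HalfTreeStabilizers.

Theorem theorem6 (T : tree) (G : set (aut T))
  (G_group : group_closed [in G])
  (G_closed : closed G)
  (G_minimal : forall S : set T,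
     subtree S -> S !=set0 -> invariant_under G S -> S = setT)
  (G_no_fixed_end : forall E, is_end E -> ~ fixes_end G E)
  (G_H : property_H G) :
  (forall N : set (aut T), closed_subgroup_of G N -> N <> [set 1] ->
     normalizes (Gplusplus G) N -> Gplusplus G `<=` N) /\
  topologically_simple (Gplusplus G).
Proof.
have Gd := minimal_displacing G_group G_minimal G_no_fixed_end.
have main (N : set (aut T)) : group_closed [in N] -> N `<=` G -> closed N ->
    N <> [set 1] -> normalizes (Gplusplus G) N -> Gplusplus G `<=` N.
  move=> Ng NG Nc Nn1 nN; have /group_closedP[N1 NM NV] := Ng.
  rewrite [X in _ `<=` X](closure_id N).1 //; apply: closureS.
  apply: smallest_sub => // g [X hX gX].
  have sides := displacing_half_tree Gd hX.
  case: (hX) (gX) => a [b [ab _ _ ->]] {}gX.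
  have [s [Gs sfix] [t [z [w [tz wz st sz sw]]]]] :=
    property_H_fork G_group G_H (sides a b ab) ab.
  have Gconj := stab_group_conj G_group sides.
  (* Displacement is handed down from [G] to [stab_group G] to [N]. *)
  have Sd : displacing (stab_group G).
    apply: (displacing_normal G_group Gd Gconj).
    exists s, w, z; split=> //; last exact: fork_displaces.
    exact: stab_group_gen (sides a b ab) _.
  have Nd : displacing N.
    apply: (displacing_normal (stab_group_closed G) Sd).
      move=> h n Sh Nn; rewrite -(nN h) ?/Gplusplus; first by exists n.
      exact: subset_closure.
    have [n Nn n1] : exists2 n, N n & n <> 1.
      apply: contrapT => nn; apply: Nn1; apply/seteqP; split=> [n Nn|_ ->//].
      by apply: contrapT => n1; apply: nn; exists n.
    have swz : adj (s w) z by rewrite -sz aut_adj.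
    have tw : t <> w by move=> E; apply: sw; rewrite -E.
    have tsw : t <> s w by move=> E; apply/tw/(@autI _ s); rewrite st.
    have [u [v [uv nuv]]] := branch_displaces tz wz swz tw tsw (nesym sw) n1.
    by exists n, u, v.
  exact: half_tree_stab_sub gX.
split=> [N [Ng NG Nc]|N [Ng NP Nc] nN].
  by apply: main => //; exact: closed_subspace_of Nc.
have PG := Gplusplus_sub G_group G_closed.
have [->|N1] := pselect (N = [set 1]); [by left|right].
apply/seteqP; split=> //; apply: main => //; first exact: subset_trans PG.
have Pc : closed (Gplusplus G) by exact: closed_closure.
exact: closed_subspace_of Pc NP Nc.
Qed.
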